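(* Let $\varrho\in(0,1)$, and suppose that the penalty function $\mathrm{pen}:\Theta\to\mathbb R$ and the constant $\mathfrak Q(\varrho)$ are such that $$\mathbf E\exp\Bigl\{\varrho\bigl[\mathcal L(\tilde\theta,\theta_0)+\mathfrak M(\tilde\theta,\theta_0)-\mathrm{pen}(\tilde\theta)\bigr]\Bigr\}\le\mathfrak Q(\varrho).$$ Then for any set $A\subset\Theta$ $$\mathbf P(\tilde\theta\notin A)\le\mathfrak Q(\varrho)\,e^{-\varrho\,\mathfrak z(A)},\qquad \mathfrak z(A):=\inf_{\theta\notin A}\{\mathfrak M(\theta,\theta_0)-\mathrm{pen}(\theta)\}.$$
   Context: $\Theta\subseteq\mathbb R^p$, and $(\mathcal L(\theta))_{\theta\in\Theta}$ is a real-valued random process on a probability space with measure $\mathbf P$ and expectation $\mathbf E$ (e.g. a scaled quasi log-likelihood). $\theta_0=\arg\max_{\theta\in\Theta}\mathbf E\mathcal L(\theta)$, $\tilde\theta=\arg\max_{\theta\in\Theta}\mathcal L(\theta)$, $\mathcal L(\theta,\theta')=\mathcal L(\theta)-\mathcal L(\theta')$. The rate function $\mathfrak M(\theta,\theta_0)=-\log\mathbf E\exp\{\mathcal L(\theta,\theta_0)\}$ is assumed finite for all $\theta\in\Theta$. In the infimum, $\theta$ ranges over $\Theta\setminus A$. *)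

(* Defs.v *)
From HB Require Import structures.
From mathcomp Require Import all_boot all_order all_algebra.
From mathcomp Require Import all_classical all_reals all_analysis.

Set Implicit Arguments.
Unset Strict Implicit.
Unset Printing Implicit Defensive.

Import Order.TTheory GRing.Theory Num.Theory.
Import numFieldNormedType.Exports.

Local Open Scope classical_set_scope.
Local Open Scope ring_scope.

(* The maximizer is not required to be unique. *)
Definition is_argmax {d : Order.disp_t} {V : porderType d} {T : Type}
    (D : set T) (f : T -> V) (x : T) : Prop :=
  D x /\ forall y, D y -> (f y <= f x)%O.

Section RateFunction.
Context {R : realType} {d : measure_display} {Omega : measurableType d}.
Variables (P : probability Omega R) (p : nat).
Variable L : 'rV[R]_p -> Omega -> R.

Definition excess (theta theta' : 'rV[R]_p) (w : Omega) : R :=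
  L theta w - L theta' w.

(* Extended-real valued: it is -oo when the exponential moment is infinite. *)
Definition rate (theta theta' : 'rV[R]_p) : \bar R :=
  (- lne 'E_P[fun w => expR (excess theta theta' w)])%E.

(* The infimum over the empty set (A = Theta) is +oo. *)
Definition zfrak (Theta : set 'rV[R]_p) (theta0 : 'rV[R]_p)
    (pen : 'rV[R]_p -> R) (A : set 'rV[R]_p) : \bar R :=
  ereal_inf [set (rate theta theta0 - (pen theta)%:E)%E | theta in Theta `\` A].

End RateFunction.

(* Main.v *)
(* Exponential Chebyshev bound for the bracket [X] in the exponent: since
   L(thetat, theta0) >= 0 by maximality, [X >= zfrak] whenever thetat is outside
   [A]. *)
Require Import Defs.
From HB Require Import structures.
From mathcomp Require Import all_boot all_order all_algebra.
From mathcomp Require Import all_classical all_reals all_analysis.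
From mathcomp Require Import measurable_realfun.

Set Implicit Arguments.
Unset Strict Implicit.
Unset Printing Implicit Defensive.

Import Order.TTheory GRing.Theory Num.Theory.
Import numFieldNormedType.Exports.

Local Open Scope classical_set_scope.
Local Open Scope ring_scope.

(** Outside [A] the real-valued [X] dominates [zfrak], so Markov's inequality for [expR (rho * X)]
    ([chernoff]) gives the bound when [zfrak] is finite. As an infimum in [\bar R], [zfrak] may also
    be infinite: at [+oo] the event is empty, and at [-oo] the bound is trivial once [Q] is
    positive, which follows from positivity of the exponential moment. *)

(** If the moment vanished, its nonnegative integrand would be zero almost everywhere; an
    exponential never vanishes, so the whole space would be null. *)
Lemma mmt_gen_fun_gt0 (R : realType) (d : measure_display)
    (T : measurableType d) (P : probability T R) (X : {RV P >-> R}) (r : R) :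
  (0 < 'M_P X r)%E.
Proof.
have M_ge0 : (0 <= 'M_P X r)%E.
  by apply: expectation_ge0 => x; exact: expR_ge0.
rewrite lt_neqAle M_ge0 andbT; apply/eqP => /esym.
rewrite /mmt_gen_fun unlock => M0.
have mf : measurable_fun setT (EFin \o (fun x => expR (r * X x))).
  apply/measurable_EFinP; apply: measurableT_comp => //.
  exact: measurable_funM.
have /(ae_eq_integral_abs P measurableT mf) :
    (\int[P]_x `|(expR (r * X x))%:E| = 0)%E.
  rewrite -[RHS]M0; apply: eq_integral => x _.
  by rewrite gee0_abs ?lee_fin ?expR_ge0//= mulrC.
move=> [N [mN PN0 subN]].
have /eqP : P N = 1%E.
  rewrite -(@probability_setT _ _ _ P); congr (P _).
  rewrite -subTset => x _; apply: subN => /= /(_ I) /eqP.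
  by rewrite eqe gt_eqF ?expR_gt0.
by rewrite PN0 lt_eqF ?lte01.
Qed.

Theorem corollary2p3 (R : realType) (p : nat) (Theta : set 'rV[R]_p)
    (d : measure_display) (Omega : measurableType d)
    (P : probability Omega R)
    (L : 'rV[R]_p -> Omega -> R)
    (mL : forall theta, Theta theta -> measurable_fun setT (L theta))
    (theta0 : 'rV[R]_p)
    (theta0_argmax : is_argmax Theta (fun theta => ('E_P[L theta])%E) theta0)
    (thetat : Omega -> 'rV[R]_p)
    (thetat_argmax :
      forall w, is_argmax Theta (fun theta => L theta w) (thetat w))
    (rate_fin : forall theta, Theta theta -> rate P L theta theta0 \is a fin_num)
    (rho : R) (rho_gt0 : 0 < rho) (rho_lt1 : rho < 1)
    (pen : 'rV[R]_p -> R) (Q : R)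
    (m_exponent : measurable_fun setT (fun w =>
      excess L (thetat w) theta0 w + fine (rate P L (thetat w) theta0)
        - pen (thetat w)))
    (exp_bound :
      ('E_P[fun w => expR (rho *
         (excess L (thetat w) theta0 w + fine (rate P L (thetat w) theta0)
            - pen (thetat w)))] <= Q%:E)%E)
    (A : set 'rV[R]_p) (A_sub : A `<=` Theta)
    (mA : measurable [set w | ~ A (thetat w)]) :
  (P [set w | ~ A (thetat w)]
    <= Q%:E * expeR (- (rho%:E * zfrak P L Theta theta0 pen A)))%E.
Proof.
pose X w := excess L (thetat w) theta0 w + fine (rate P L (thetat w) theta0)
  - pen (thetat w).
pose XRV : {RV P >-> R} := mfun_Sub (mem_set m_exponent).
have MQ : ('M_P XRV rho <= Q%:E)%E.
  apply: le_trans exp_bound; rewrite le_eqVlt; apply/orP; left; apply/eqP.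
  by congr expectation; apply/funext => w /=; rewrite mulrC.
have thT w : Theta (thetat w) by case: (thetat_argmax w).
have z_le w : ~ A (thetat w) -> (zfrak P L Theta theta0 pen A <= (X w)%:E)%E.
  move=> nA; apply: (@le_trans _ _
      (rate P L (thetat w) theta0 - (pen (thetat w))%:E)%E).
    by apply: ereal_inf_lbound; exists (thetat w).
  (* With the rate finite, the comparison reduces to a nonnegative excess: [thetat w] maximizes over
     [Theta], which contains [theta0]. *)
  rewrite -(fineK (rate_fin _ (thT w))) -EFinB lee_fin lerB// lerDr subr_ge0.
  by case: (thetat_argmax w) => _; apply; case: theta0_argmax.
case: zfrak z_le => [z||] z_le.
- apply: (@le_trans _ _ (P [set w | z <= XRV w])).
    apply: le_measure; rewrite ?inE//.
    have := measurable_fun_le measurableT (measurable_cst z) m_exponent.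
    by rewrite setTI.
  apply: le_trans (chernoff XRV z rho_gt0) _.
  by apply: lee_wpmul2r; rewrite ?lee_fin ?expR_ge0.
(* No real [X w] dominates [+oo]; the right-hand side is also [0], since [expeR -oo] is [0]. *)
- suff -> : [set w | ~ A (thetat w)] = set0.
    by rewrite measure0 gt0_muley ?lte_fin//= mule0.
  by apply/seteqP; split => // w /= /z_le; rewrite leNgt ltry.
- (* The bound is [Q * +oo], which is [0] unless [Q > 0]. *)
  have Q_gt0 : (0 < Q%:E)%E by apply: lt_le_trans MQ; exact: mmt_gen_fun_gt0.
  by rewrite gt0_muleNy ?lte_fin//= gt0_muley// leey.
Qed.
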